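(* Let $b, t, n$ be positive integers with $t \ge b$. Then the set $\mathcal{H}_{b,t}(n)$ of hyper $(b,t)$-ary partitions of $n$, partially ordered by refinement, is a lattice.
   Context: A partition of a positive integer $n$ is a finite multiset $\lambda=\{\lambda_1\ge\cdots\ge\lambda_k\}$ of positive integers (its parts) with $\sum_i\lambda_i=n$. For positive integers $b,t$ with $t\ge b$, a hyper $(b,t)$-ary partition of $n$ is a partition of $n$ all of whose parts are powers $b^j$ of $b$ ($j\ge 0$, so $b^0=1$ is allowed), each part size occurring with multiplicity at most $t$. $\mathcal{H}_{b,t}(n)$ denotes the set of all hyper $(b,t)$-ary partitions of $n$. Refinement order: for partitions $\lambda,\mu$ of $n$, $\mu\le\lambda$ if the parts of $\mu$ can be obtained from $\lambda$ by combining parts, i.e. the multiset of parts of $\lambda$ can be divided into disjoint nonempty groups whose sums, taken as a multiset, are exactly the parts of $\mu$. $\mathcal{H}_{b,t}(n)$ carries the restriction of this order. A poset is a lattice if every pair of elements $x,y$ has a least upper bound $x\lor y$ and a greatest lower bound $x\land y$. *)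

(* Defs.v *)
From HB Require Import structures.
From mathcomp Require Import all_boot all_order.
From mathcomp Require Import boolp classical_sets.

Set Implicit Arguments.
Unset Strict Implicit.
Unset Printing Implicit Defensive.

Import Order.TTheory.

(* A finite multiset of positive integers is encoded by its nonincreasing
   listing, so that Leibniz equality of [partn n] is equality of multisets. *)
Definition is_partn (n : nat) (s : seq nat) : bool :=
  [&& sorted geq s, all (leq 1) s & sumn s == n].

Record partn (n : nat) : Type := Partn {
  parts :> seq nat;
  partsP : is_partn n parts
}.

HB.instance Definition _ n := [isSub for @parts n].
HB.instance Definition _ n := [Choice of partn n by <:].

(* [gs] is the list of groups into which the parts of [la] are divided. *)
Definition combines (mu la : seq nat) : Prop :=
  exists gs : seq (seq nat),
    [/\ [::] \notin gs, perm_eq (flatten gs) la & perm_eq (map sumn gs) mu].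

Lemma perm_eq_map_lift (T U : eqType) (f : T -> U) (s : seq T) (u : seq U) :
  perm_eq u (map f s) -> exists2 s', perm_eq s' s & map f s' = u.
Proof.
case: s => [|x s]; first by move/perm_nilP->; exists [::].
move=> /(perm_iotaP (f x))[Is pIs ->].
exists (map (nth x (x :: s)) Is).
  by apply/(perm_iotaP x); exists Is => //; move: pIs; rewrite size_map.
rewrite -map_comp; apply/eq_in_map => i; rewrite (perm_mem pIs) mem_iota.
by rewrite size_map => /andP[_ lti] /=; rewrite -(nth_map x (f x) f).
Qed.

Lemma combines_refl (la : seq nat) : combines la la.
Proof.
exists [seq [:: x] | x <- la]; split; first by apply/mapP => -[].
  by rewrite (flatten_map1 id) map_id.
rewrite -map_comp (@eq_map _ _ _ id) ?map_id// => x.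
by rewrite /= addn0.
Qed.

Lemma combines_trans (la mu nu : seq nat) :
  combines nu mu -> combines mu la -> combines nu la.
Proof.
move=> [hs [h0 hmu hnu]] [gs [g0 gla gmu]].
have phg : perm_eq (flatten hs) (map sumn gs).
  by rewrite (permPl hmu) perm_sym.
have [gs' pgs' egs'] := perm_eq_map_lift phg.
have szgs' : size gs' = sumn (shape hs).
  by rewrite -size_flatten -egs' size_map.
have ek : map (map sumn) (reshape (shape hs) gs') = hs.
  by rewrite map_reshape egs' flattenK.
have fk : flatten (reshape (shape hs) gs') = gs'.
  by rewrite reshapeKr// szgs'.
set ks := reshape _ _ in ek fk.
exists (map flatten ks); split.
- apply/mapP => -[k kks /esym ek0].
  have : all (fun g => g == [::]) k.
    apply/allP => g gk; apply/eqP; case: g gk => [|y g] gk //.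
    have : y \in flatten k by apply/flattenP; exists (y :: g); rewrite ?mem_head.
    by rewrite ek0.
  case: k kks {ek0} => [|g k] kks /=.
    by case/negP: h0; rewrite -ek; apply/mapP; exists [::].
  case/andP=> /eqP g_nil _; case/negP: g0; rewrite -(perm_mem pgs') -fk.
  by apply/flattenP; exists (g :: k); rewrite // g_nil mem_head.
- have -> : flatten (map flatten ks) = flatten (flatten ks).
    by elim: (ks) => //= k l ->; rewrite flatten_cat.
  by rewrite fk (permPl (perm_flatten pgs')).
- rewrite -(permPr hnu) -ek -!map_comp (@eq_map _ _ _ (sumn \o map sumn))//.
  by move=> k; rewrite /= sumn_flatten.
Qed.

Lemma size_nonempty_flatten (T : eqType) (gs : seq (seq T)) :
  [::] \notin gs ->
  size gs <= size (flatten gs) ?= iff all (fun g => size g == 1) gs.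
Proof.
elim: gs => [|g gs IH]; first by split.
rewrite in_cons negb_or => /andP[g0 /IH{}IH] /=.
rewrite size_cat -add1n; apply: leqif_add IH.
by case: g g0 => [|x [|y g]] //= _; split.
Qed.

Lemma combines_size (mu la : seq nat) : combines mu la -> size mu <= size la.
Proof.
move=> [gs [g0 /perm_size <- /perm_size <-]].
by rewrite size_map (size_nonempty_flatten g0).
Qed.

Lemma combines_size_eq (mu la : seq nat) :
  combines mu la -> size la <= size mu -> perm_eq mu la.
Proof.
move=> [gs [g0 gla gmu]].
rewrite -(perm_size gla) -(perm_size gmu) size_map.
rewrite (geq_leqif (size_nonempty_flatten g0)) => g1.
rewrite -(permPr gla) -(permPl gmu).
suff -> : map sumn gs = flatten gs by [].
elim: gs g1 {g0 gla gmu} => //= -[|x [|y g]] gs IH //= /IH ->.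
by rewrite addn0.
Qed.

Section Refinement.
Variable n : nat.
Implicit Types la mu nu : partn n.

Definition refines mu la : bool := `[< combines mu la >].

Lemma refinesP mu la : reflect (combines mu la) (refines mu la).
Proof. exact: asboolP. Qed.

Fact refines_refl : reflexive refines.
Proof. by move=> la; apply/refinesP/combines_refl. Qed.

Fact refines_anti : antisymmetric refines.
Proof.
move=> la mu /andP[/refinesP lemu /refinesP mule]; apply/val_inj.
have /and3P[sla _ _] := partsP la; have /and3P[smu _ _] := partsP mu.
apply: (@sorted_eq _ geq) => //.
- by move=> y x z /= lexy /leq_trans; apply.
- by move=> x y /= /andP[lexy leyx]; apply/eqP; rewrite eqn_leq leyx.
- exact/combines_size_eq/combines_size.
Qed.

Fact refines_trans : transitive refines.
Proof.
by move=> mu nu la /refinesP h1 /refinesP h2; apply/refinesP/(combines_trans h1).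
Qed.

End Refinement.

Fact refinement_display : Order.disp_t. Proof. exact: Order.Disp tt tt. Qed.

HB.instance Definition _ n := Order.Le_isPOrder.Build refinement_display
  (partn n) (@refines_refl n) (@refines_anti n) (@refines_trans n).

Definition is_hyper (b t n : nat) (la : partn n) : Prop :=
  (forall p, p \in parts la -> exists j : nat, p = b ^ j) /\
  (forall p, count_mem p (parts la) <= t).

Record hyper_partn (b t n : nat) : Type := HyperPartn {
  hyper_val :> partn n;
  hyper_valP : `[< is_hyper b t hyper_val >]
}.

HB.instance Definition _ b t n := [isSub for @hyper_val b t n].
HB.instance Definition _ b t n := [Choice of hyper_partn b t n by <:].
HB.instance Definition _ b t n :=
  [SubChoice_isSubPOrder of hyper_partn b t n by <: with refinement_display].

Lemma hyper_leP (b t n : nat) (x y : hyper_partn b t n) :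
  reflect (combines (parts (hyper_val x)) (parts (hyper_val y))) (x <= y)%O.
Proof. exact: refinesP. Qed.

(* [latticeType] carries join and meet as data; this is the corresponding
   property of a poset. *)
Definition is_lattice (d : Order.disp_t) (T : porderType d) : Prop :=
  forall x y : T,
    (exists z, supremums [set x; y]%classic z) /\
    (exists z, infimums [set x; y]%classic z).

(* Main.v *)
Require Import Defs.
From mathcomp Require Import all_boot all_order.
From mathcomp Require Import boolp.
From mathcomp Require Import zify.

(* For [b > 1], encode a partition into powers of [b] by the sequence
   [s_k = \sum_p p %/ b ^ k].  The multiplicity of [b ^ k] is
   [s_k - b * s_(k+1)], so hyper (b,t)-ary partitions correspond to the
   sequences with [s_0 = n], [s_k = 0] eventually and
   [0 <= s_k - b * s_(k+1) <= t].  Combining parts can only increase every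
   [s_k]; conversely, if [s_k] agrees for two partitions and the finer one has
   a smaller [s_(k+1)], then it has at least [b] parts [b ^ k], and merging
   them increases [s_(k+1)] by one and nothing else.  Hence refinement is the
   reversed pointwise order on these sequences, and the constraints above are
   stable under pointwise minimum and maximum. *)

(** * Floor sums and multiplicities *)

Definition floor_sum (b k : nat) (la : seq nat) : nat :=
  sumn [seq p %/ b ^ k | p <- la].

Definition powers_of (b : nat) (la : seq nat) : Prop :=
  forall p, p \in la -> exists j, p = b ^ j.

Lemma powers_of_cons b p la :
  powers_of b (p :: la) -> (exists j, p = b ^ j) /\ powers_of b la.
Proof.
move=> H; split=> [|q qla]; apply: H; first exact: mem_head.
by rewrite in_cons qla orbT.
Qed.

Lemma floor_sum_perm b k la mu :
  perm_eq la mu -> floor_sum b k la = floor_sum b k mu.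
Proof. by move=> h; apply/perm_sumn/perm_map. Qed.

Lemma floor_sum_cat b k la mu :
  floor_sum b k (la ++ mu) = floor_sum b k la + floor_sum b k mu.
Proof. by rewrite /floor_sum map_cat sumn_cat. Qed.

Lemma floor_sum_nseq b k m p :
  floor_sum b k (nseq m p) = m * (p %/ b ^ k).
Proof. by rewrite /floor_sum map_nseq sumn_nseq mulnC. Qed.

Lemma floor_sum0 b la : floor_sum b 0 la = sumn la.
Proof. by rewrite /floor_sum (@eq_map _ _ _ id) ?map_id// => p; exact: divn1. Qed.

(** Floor division is superadditive. Applied to each group of a combination, this makes floor sums
    grow when parts are combined. *)
Lemma floor_sum_leq b k la : 0 < b -> floor_sum b k la <= sumn la %/ b ^ k.
Proof.
move=> b0; rewrite leq_divRL ?expn_gt0 ?b0//.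
elim: la => //= p la IH.
by rewrite mulnDl leq_add// leq_divM.
Qed.

Lemma floor_sum_combines b k mu la :
  0 < b -> combines mu la -> floor_sum b k la <= floor_sum b k mu.
Proof.
move=> b0 [gs [_ gla gmu]].
rewrite -(floor_sum_perm b k _ _ gla) -(floor_sum_perm b k _ _ gmu).
elim: gs {gla gmu} => //= g gs IH.
by rewrite floor_sum_cat leq_add// floor_sum_leq.
Qed.

Lemma floor_sum_large b k n la :
  1 < b -> sumn la = n -> n <= k -> floor_sum b k la = 0.
Proof.
move=> b1 lan nk; apply/eqP; rewrite -leqn0.
have nbk : sumn la < b ^ k by rewrite lan; exact: leq_ltn_trans nk (ltn_expl k b1).
by rewrite -[X in _ <= X](divn_small nbk) floor_sum_leq// ltnW.
Qed.

(** For [j < k] both quotients vanish, for [j > k] both are exact powers, and for [j = k] they are 1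
    and 0. *)
Lemma divn_expS b j k : 1 < b ->
  b ^ j %/ b ^ k = (b ^ j == b ^ k) + b * (b ^ j %/ b ^ k.+1).
Proof.
move=> b1; have b0 : 0 < b by exact: ltnW.
rewrite eqn_exp2l//; case: (ltngtP j k) => jk.
- by rewrite !divn_small ?muln0// ltn_exp2l// ltnS ltnW.
- by rewrite -!expnB ?(ltnW jk)// -expnS subnSK.
- by rewrite jk divnn expn_gt0 b0 divn_small ?muln0// ltn_exp2l.
Qed.

Lemma floor_sum_count b k la : 1 < b -> powers_of b la ->
  floor_sum b k la = count_mem (b ^ k) la + b * floor_sum b k.+1 la.
Proof.
move=> b1; elim: la => [|p la IH]; first by rewrite muln0.
move=> /powers_of_cons[[j ->] /IH{IH} e].
rewrite -cat1s !floor_sum_cat e -[[:: _]]/(nseq 1 _) !floor_sum_nseq /=.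
by rewrite divn_expS //=; lia.
Qed.

Lemma floor_sum_inj b la mu : 1 < b -> powers_of b la -> powers_of b mu ->
  (forall k, floor_sum b k la = floor_sum b k mu) -> perm_eq la mu.
Proof.
move=> b1 pla pmu e; apply/allP => p; rewrite mem_cat => pin.
have [j ->] : exists j, p = b ^ j by case/orP: pin; [exact: pla|exact: pmu].
apply/eqP => /=; have := e j.
by rewrite (floor_sum_count _ _ la)// (floor_sum_count _ _ mu)// e => /addIn.
Qed.

(** * From floor sums back to refinement *)

Lemma combines_permr mu la la' :
  perm_eq la la' -> combines mu la -> combines mu la'.
Proof.
by move=> e [gs [g0 gla gmu]]; exists gs; split; rewrite // -(permPr e).
Qed.

Lemma combines_merge m p r : 0 < m -> combines (m * p :: r) (nseq m p ++ r).
Proof.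
move=> m0; exists (nseq m p :: [seq [:: x] | x <- r]); split.
- by rewrite in_cons negb_or; case: m m0 => //= m _; apply/mapP => -[].
- by rewrite /= (flatten_map1 id) map_id.
- rewrite /= sumn_nseq mulnC -map_comp (@eq_map _ _ _ id) ?map_id// => x.
  by rewrite /= addn0.
Qed.

Lemma perm_count_nseq (T : eqType) (m : nat) (p : T) (la : seq T) :
  m <= count_mem p la -> exists r, perm_eq la (nseq m p ++ r).
Proof.
move=> mla; exists (nseq (count_mem p la - m) p ++ filter (predC1 p) la).
rewrite catA cat_nseq /ncons -iterD -/(ncons _ p _) -/(nseq _ _).
rewrite subnKC// perm_sym -(permPr (permEl (perm_filterC (pred1 p) la))).
rewrite perm_cat2r.
have /all_pred1P -> : all (pred1 p) (filter (pred1 p) la) by exact: filter_all.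
by rewrite size_filter.
Qed.

(** Induction on the number of parts of [la]: each step merges [b] equal parts into one, at the
    least index where the floor sums differ. *)
Lemma combines_of_floor_sum b la mu : 1 < b -> powers_of b la -> powers_of b mu ->
  sumn la = sumn mu -> (forall k, floor_sum b k la <= floor_sum b k mu) ->
  combines mu la.
Proof.
move=> b1; have b0 : 0 < b by exact: ltnW.
have [m] := ubnP (size la); elim: m la => // m IH la lam pla pmu e0 le.
have [eqs|neq] := pselect (forall k, floor_sum b k la = floor_sum b k mu).
  apply: combines_permr (combines_refl mu).
  by rewrite perm_sym; exact: floor_sum_inj eqs.
have exk : exists k, floor_sum b k la != floor_sum b k mu.
  by apply: contrapT => h; apply: neq => k; apply: contrapT => /eqP hk; apply: h; exists k.
case: (ex_minnP exk) => -[|k] nk mink; first by rewrite !floor_sum0 e0 eqxx in nk.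
have ek : floor_sum b k la = floor_sum b k mu.
  by apply: contraTeq (ltnSn k) => /mink; rewrite -leqNgt.
have ltk : floor_sum b k.+1 la < floor_sum b k.+1 mu by rewrite ltn_neqAle nk le.
(* Comparing the count identities at [k], [la] has more copies of [b ^ k] than [mu], by [b] times
   the gap at [k.+1], hence at least [b] copies. *)
have [r lar] : exists r, perm_eq la (nseq b (b ^ k) ++ r).
  apply: perm_count_nseq; move: ek.
  rewrite (floor_sum_count _ _ la)// (floor_sum_count _ _ mu)//.
  by move: (leq_mul (leqnn b) ltk); rewrite mulnS; lia.
(* Up to index [k] all the divisions are exact, and beyond [k.+1] all quotients vanish, so the merge
   shows only at [k.+1]. *)
have fla j : floor_sum b j (b ^ k.+1 :: r) = floor_sum b j la + (j == k.+1).
  rewrite (floor_sum_perm _ _ _ _ lar) -cat1s !floor_sum_cat.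
  rewrite -[[:: _]]/(nseq 1 _) !floor_sum_nseq mul1n addnAC; congr (_ + _).
  have [->|nj] := eqVneq j k.+1.
    by rewrite divnn expn_gt0 b0 divn_small ?muln0// ltn_exp2l.
  case: (leqP j k) => jk.
    by rewrite -!expnB ?(leq_trans jk)// -expnS subSn ?addn0.
  by rewrite !divn_small ?muln0// ltn_exp2l// ltn_neqAle eq_sym nj.
have cm : combines (b ^ k.+1 :: r) la.
  apply: (@combines_permr _ (nseq b (b ^ k) ++ r)); first by rewrite perm_sym.
  by rewrite expnS; exact: combines_merge.
apply: combines_trans cm; apply: IH => //.
- move: lam; rewrite (perm_size lar) size_cat size_nseq /= ltnS; lia.
- move=> p; rewrite in_cons => /predU1P[->|pr]; first by exists k.+1.
  by apply: pla; rewrite (perm_mem lar) mem_cat pr orbT.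
- by rewrite -(floor_sum0 b) fla addn0 floor_sum0.
- move=> j; rewrite fla; have [->|_] := eqVneq; first by rewrite addn1.
  by rewrite addn0.
Qed.

(** * Hyper partitions as floor-sum sequences *)

Section Hyper.
Context {b t n : nat}.
Implicit Types x y z : hyper_partn b t n.

Lemma hyper_powers x : powers_of b (parts (hyper_val x)).
Proof. by have /asboolP[] := hyper_valP x. Qed.

Lemma hyper_count x p : count_mem p (parts (hyper_val x)) <= t.
Proof. by have /asboolP[] := hyper_valP x. Qed.

Lemma hyper_sumn x : sumn (parts (hyper_val x)) = n.
Proof. by have /and3P[_ _ /eqP] := partsP (hyper_val x). Qed.

Lemma hyper_le_floor_sum x y : 1 < b ->
  (x <= y)%O <-> forall k, floor_sum b k y <= floor_sum b k x.
Proof.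
move=> b1; split=> [/hyper_leP xy k|yx].
  exact/floor_sum_combines/xy/ltnW.
apply/hyper_leP; apply: combines_of_floor_sum yx => //; try exact: hyper_powers.
by rewrite !hyper_sumn.
Qed.

Lemma hyper_floor_sum_bounds x k : 1 < b ->
  b * floor_sum b k.+1 x <= floor_sum b k x <= t + b * floor_sum b k.+1 x.
Proof.
move=> b1; rewrite (floor_sum_count b k)//; last exact: hyper_powers.
by rewrite leq_addl leq_add2r hyper_count.
Qed.

Lemma hyper_of_floor_sum (f : nat -> nat) : 1 < b ->
    f 0 = n -> (forall k, n <= k -> f k = 0) ->
    (forall k, b * f k.+1 <= f k <= t + b * f k.+1) ->
  exists z, forall k, floor_sum b k z = f k.
Proof.
move=> b1 f0 fn fb.
(* The multiplicity that [b ^ k] must have; the lower bound in [fb] makes this truncated subtraction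
   exact. It vanishes for [k >= n], so exponents below [n] suffice in [L]. *)
pose m k := f k - b * f k.+1.
have fm k : f k = m k + b * f k.+1 by rewrite subnK//; case/andP: (fb k).
pose L := flatten [seq nseq (m k) (b ^ k) | k <- iota 0 n].
have pL : powers_of b L.
  by move=> p /flattenP[s /mapP[k _ ->]] /nseqP[-> _]; exists k.
have cL k : count_mem (b ^ k) L = m k.
  rewrite count_flatten -map_comp sumnE big_map.
  have [kn|nk] := ltnP k n.
    rewrite (bigD1_seq k) ?mem_iota ?iota_uniq//= count_nseq /= eqxx mul1n.
    rewrite big1 ?addn0// => i ik.
    by rewrite count_nseq /= eqn_exp2l// (negPf ik).
  rewrite big1_seq; first by rewrite /m !fn ?muln0// (leq_trans nk).
  move=> i /=; rewrite mem_iota add0n => lin.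
  by rewrite count_nseq /= eqn_exp2l// ltn_eqF// (leq_trans lin nk).
(* Downward induction on [k]. The start [n + sumn L] makes both sides vanish while [sumn L] is not
   yet known to equal [n]. *)
have Lf k : floor_sum b k L = f k.
  have large i : n + sumn L <= i -> floor_sum b i L = f i.
    by move=> h; rewrite (@floor_sum_large b i (sumn L))// ?fn//; lia.
  have [d] := ubnP (n + sumn L - k); elim: d k => // d IH k hd.
  have [/large//|ki] := leqP (n + sumn L) k.
  by rewrite floor_sum_count// cL IH -?fm//; lia.
have sL : perm_eq (sort geq L) L by rewrite perm_sort.
have Ln : is_partn n (sort geq L).
  apply/and3P; split.
  - by apply: sort_sorted => x y; exact: leq_total.
  - apply/allP => p; rewrite (perm_mem sL) => /pL[j ->].
    by rewrite expn_gt0 ltnW.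
  - by rewrite (perm_sumn sL) -(floor_sum0 b) Lf f0.
have hL : `[< is_hyper b t (Partn Ln) >].
  apply/asboolP; split=> p /=; first by rewrite (perm_mem sL); exact: pL.
  rewrite (permP sL).
  have [/pL[j ->]|/count_memPn -> //] := boolP (p \in L).
  by rewrite cL leq_subLR addnC; case/andP: (fb j).
by exists (HyperPartn hL) => k; rewrite (floor_sum_perm _ _ _ _ sL).
Qed.

End Hyper.

(** * The degenerate base and the lattice property *)

Lemma hyper1_eq t n (x y : hyper_partn 1 t n) : x = y.
Proof.
suff parts1 (z : hyper_partn 1 t n) : parts (hyper_val z) = nseq n 1.
  by apply/val_inj/val_inj; rewrite /= !parts1.
have /all_pred1P e : all (pred1 1) (parts (hyper_val z)).
  by apply/allP => p /hyper_powers[j ->]; rewrite /= exp1n.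
by rewrite e; congr nseq; rewrite -[RHS](hyper_sumn z) e sumn_nseq mul1n size_nseq.
Qed.

Theorem theorem3p7 (b t n : nat) (hb : 0 < b) (ht : 0 < t) (hn : 0 < n)
  (hbt : b <= t) : is_lattice (hyper_partn b t n).
Proof.
move: hb; rewrite leq_eqVlt => /predU1P[b1|b1] x y.
  move: x y; rewrite -b1 => x y.
  by split; exists x; split=> z _; rewrite ?(hyper1_eq _ _ z x)// => ? _;
    rewrite (hyper1_eq _ _ x z).
have s0 (z : hyper_partn b t n) : floor_sum b 0 z = n.
  by rewrite floor_sum0 hyper_sumn.
have large (z : hyper_partn b t n) k : n <= k -> floor_sum b k z = 0.
  exact/floor_sum_large/hyper_sumn.
split.
(* The order is reversed on floor sums, so the pointwise minimum gives the join. *)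
- have [|k nk|k|z ze] := @hyper_of_floor_sum b t n
    (fun k => minn (floor_sum b k x) (floor_sum b k y)) b1.
  + by rewrite !s0 minnn.
  + by rewrite !large.
  (* Multiplication by [b] and addition of [t] are monotone, hence commute with the minimum, and
     both bounds survive. *)
  + have := hyper_floor_sum_bounds x k b1; have := hyper_floor_sum_bounds y k b1.
    by rewrite minnMr; lia.
  exists z; split=> [w /= [] ->|w h].
  + by apply/hyper_le_floor_sum => // k; rewrite ze geq_minl.
  + by apply/hyper_le_floor_sum => // k; rewrite ze geq_minr.
  apply/hyper_le_floor_sum => // k; rewrite ze leq_min; apply/andP; split;
    apply: (proj1 (hyper_le_floor_sum _ _ b1) _ k); apply: h; by [left|right].
(* Dually, the pointwise maximum gives the meet. *)
- have [|k nk|k|z ze] := @hyper_of_floor_sum b t n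
    (fun k => maxn (floor_sum b k x) (floor_sum b k y)) b1.
  + by rewrite !s0 maxnn.
  + by rewrite !large.
  + have := hyper_floor_sum_bounds x k b1; have := hyper_floor_sum_bounds y k b1.
    by rewrite maxnMr; lia.
  exists z; split=> [w /= [] ->|w h].
  + by apply/hyper_le_floor_sum => // k; rewrite ze leq_maxl.
  + by apply/hyper_le_floor_sum => // k; rewrite ze leq_maxr.
  apply/hyper_le_floor_sum => // k; rewrite ze geq_max; apply/andP; split;
    apply: (proj1 (hyper_le_floor_sum _ _ b1) _ k); apply: h; by [left|right].
Qed.
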